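(* Let $A$ be a commutative ring and $L$ an $A$-module. Then $L$ is invertible if and only if there exist a finite family $(s_i)$ of elements of $A$ generating the unit ideal (i.e. $\sum_i As_i=A$) and, for each $i$, an isomorphism of $A_{s_i}$-modules $A_{s_i}\simeq L_{s_i}$.
   Context: For $s\in A$, $A_s$ and $L_s$ denote the ring, respectively module, of fractions whose denominators are powers of $s$. An $A$-module is called invertible if it is projective, finitely generated and of rank $1$. Here a finitely generated $A$-module $L$ has rank $n$ if for every prime ideal $\mathfrak{p}$ of $A$, with $\kappa(\mathfrak{p})$ the fraction field of $A/\mathfrak{p}$, the $\kappa(\mathfrak p)$-vector space $(L/\mathfrak{p}L)_{\mathfrak{p}}=\kappa(\mathfrak{p})\otimes_A L$ has dimension $n$. *)

(* Defs.v *)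
From HB Require Import structures.
From mathcomp Require Import all_boot all_algebra ring boolp.

Set Implicit Arguments.
Unset Strict Implicit.
Unset Printing Implicit Defensive.

Import GRing.Theory.
Local Open Scope ring_scope.
Local Open Scope quotient_scope.

Section FracMod.
Variables (A : comPzRingType) (S : mulrClosed A).

Definition denom := {t : A | t \in S}.

Definition denom1 : denom := exist _ 1 (rpred1 S).

Definition denomM (s t : denom) : denom :=
  exist _ (sval s * sval t) (rpredM (svalP s) (svalP t)).

Variable M : lmodType A.

Definition frac_equiv (x y : M * denom) : bool :=
  `[< exists2 u, u \in S & u *: (sval y.2 *: x.1) = u *: (sval x.2 *: y.1) >].

Lemma frac_equiv_class : equiv_class_of frac_equiv.
Proof.
split=> [x|x y|y x z].
- by apply/asboolP; exists 1; rewrite ?rpred1.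
- by apply/asboolP/asboolP => -[u Su e]; exists u.
- move=> /asboolP[u Su e1] /asboolP[v Sv e2]; apply/asboolP.
  exists (u * v * sval y.2); first by rewrite !rpredM ?(svalP y.2).
  have -> : (u * v * sval y.2) *: (sval z.2 *: x.1) =
            (v * sval z.2) *: (u *: (sval y.2 *: x.1)).
    by rewrite !scalerA; congr (_ *: _); ring.
  rewrite e1.
  have -> : (v * sval z.2) *: (u *: (sval x.2 *: y.1)) =
            (u * sval x.2) *: (v *: (sval z.2 *: y.1)).
    by rewrite !scalerA; congr (_ *: _); ring.
  by rewrite e2 !scalerA; congr (_ *: _); ring.
Qed.

Canonical frac_equiv_equiv := EquivRelPack frac_equiv_class.
Canonical frac_equiv_encModRel := defaultEncModRel frac_equiv.

Definition fracmod := {eq_quot frac_equiv}.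
HB.instance Definition _ := Choice.on fracmod.

Definition mkfrac (x : M) (t : denom) : fracmod := \pi_fracmod (x, t).

Definition fracnum (v : fracmod) : M := (repr v).1.
Definition fracden (v : fracmod) : denom := (repr v).2.

Lemma fracE v : mkfrac (fracnum v) (fracden v) = v.
Proof. by rewrite /mkfrac /fracnum /fracden -surjective_pairing reprK. Qed.

Lemma fracW (P : fracmod -> Prop) :
  (forall x t, P (mkfrac x t)) -> forall v, P v.
Proof. by move=> h v; rewrite -(fracE v). Qed.

Lemma mkfrac_eq x s y t :
  mkfrac x s = mkfrac y t <->
  exists2 u, u \in S & u *: (sval t *: x) = u *: (sval s *: y).
Proof.
split=> [/eqmodP /asboolP //|e].
by apply/eqmodP/asboolP.
Qed.

Lemma mkfracK x s : exists2 u, u \in S &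
  u *: (sval s *: fracnum (mkfrac x s)) = u *: (sval (fracden (mkfrac x s)) *: x).
Proof. by case/mkfrac_eq: (fracE (mkfrac x s)) => u Su e; exists u. Qed.

Definition fracmod_zero : fracmod := mkfrac 0 denom1.
Definition fracmod_opp (v : fracmod) : fracmod :=
  mkfrac (- fracnum v) (fracden v).
Definition fracmod_add (v w : fracmod) : fracmod :=
  mkfrac (sval (fracden w) *: fracnum v + sval (fracden v) *: fracnum w)
         (denomM (fracden v) (fracden w)).

Lemma fracmod_oppE x s : fracmod_opp (mkfrac x s) = mkfrac (- x) s.
Proof.
apply/mkfrac_eq; have [u Su e] := mkfracK x s; exists u => //.
by rewrite !scalerN e.
Qed.

Lemma fracmod_addE x s y t :
  fracmod_add (mkfrac x s) (mkfrac y t) =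
  mkfrac (sval t *: x + sval s *: y) (denomM s t).
Proof.
apply/mkfrac_eq => /=.
have [u Su] := mkfracK x s.
move: (fracnum (mkfrac x s)) (fracden (mkfrac x s)) => x' s' e1.
have [v Sv] := mkfracK y t.
move: (fracnum (mkfrac y t)) (fracden (mkfrac y t)) => y' t' e2.
exists (u * v); first by rewrite rpredM.
rewrite !scalerDr; congr (_ + _).
  transitivity ((v * sval t * sval t') *: (u *: (sval s *: x'))).
    by rewrite !scalerA; congr (_ *: _); ring.
  by rewrite e1 !scalerA; congr (_ *: _); ring.
transitivity ((u * sval s * sval s') *: (v *: (sval t *: y'))).
  by rewrite !scalerA; congr (_ *: _); ring.
by rewrite e2 !scalerA; congr (_ *: _); ring.
Qed.

Lemma fracmod_addA : associative fracmod_add.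
Proof.
elim/fracW=> x s; elim/fracW=> y t; elim/fracW=> z r; rewrite !fracmod_addE.
apply/mkfrac_eq; exists 1; rewrite ?rpred1 //= !scale1r !scalerDr !scalerA addrA.
by congr (_ *: _ + _ *: _ + _ *: _); ring.
Qed.

Lemma fracmod_addC : commutative fracmod_add.
Proof.
elim/fracW=> x s; elim/fracW=> y t; rewrite !fracmod_addE.
apply/mkfrac_eq; exists 1; rewrite ?rpred1 //= !scale1r addrC.
by rewrite [sval s * _]mulrC.
Qed.

Lemma fracmod_add0 : left_id fracmod_zero fracmod_add.
Proof.
elim/fracW=> x s; rewrite !fracmod_addE.
by apply/mkfrac_eq; exists 1; rewrite ?rpred1 //= scaler0 add0r !scale1r mul1r.
Qed.

Lemma fracmod_addN : left_inverse fracmod_zero fracmod_opp fracmod_add.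
Proof.
elim/fracW=> x s; rewrite fracmod_oppE !fracmod_addE.
by apply/mkfrac_eq; exists 1; rewrite ?rpred1 //= scalerN addNr !scaler0.
Qed.

HB.instance Definition _ := GRing.isZmodule.Build fracmod
  fracmod_addA fracmod_addC fracmod_add0 fracmod_addN.

Lemma addfracE x s y t :
  mkfrac x s + mkfrac y t = mkfrac (sval t *: x + sval s *: y) (denomM s t).
Proof. exact: fracmod_addE. Qed.

Lemma oppfracE x s : - mkfrac x s = mkfrac (- x) s.
Proof. exact: fracmod_oppE. Qed.

End FracMod.

Arguments fracmod {A} S M.
Arguments mkfrac {A S M} x t.

Section FracScale.
Variables (A : comPzRingType) (S : mulrClosed A) (M : lmodType A).

Lemma ringfracW (P : fracmod S A^o -> Prop) :
  (forall (a : A) t, P (mkfrac (a : A^o) t)) -> forall v, P v.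
Proof. by move=> h; apply: (@fracW A S A^o P). Qed.

Definition fracscale (a : fracmod S A^o) (v : fracmod S M) : fracmod S M :=
  mkfrac ((fracnum a : A) *: fracnum v) (denomM (fracden a) (fracden v)).

Lemma fracscaleE (a : A) s (x : M) t :
  fracscale (mkfrac (a : A^o) s) (mkfrac x t) = mkfrac (a *: x) (denomM s t).
Proof.
apply/mkfrac_eq => /=.
have [u Su] := mkfracK (a : A^o) s.
move: (fracnum (mkfrac (a : A^o) s)) (fracden (mkfrac (a : A^o) s)) => a' s' e1.
have [v Sv] := mkfracK x t.
move: (fracnum (mkfrac x t)) (fracden (mkfrac x t)) => x' t' e2.
exists (u * v); first by rewrite rpredM.
transitivity ((u *: (sval s *: a') : A) *: (v *: (sval t *: x'))).
  by rewrite !scalerA; congr (_ *: _); rewrite /GRing.scale /=; ring.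
by rewrite e1 e2 !scalerA; congr (_ *: _); rewrite /GRing.scale /=; ring.
Qed.

End FracScale.

Lemma fracmulE (A : comPzRingType) (S : mulrClosed A) (a b : A) (s t : denom S) :
  fracscale (mkfrac (a : A^o) s) (mkfrac (b : A^o) t) =
  mkfrac (a * b : A^o) (denomM s t).
Proof. exact: fracscaleE. Qed.

Section FracScaleTheory.
Variables (A : comPzRingType) (S : mulrClosed A) (M : lmodType A).
Implicit Types (a b : fracmod S A^o) (v w : fracmod S M).

Lemma fracscaleA a b v :
  fracscale a (fracscale b v) = fracscale (fracscale a b) v.
Proof.
elim/ringfracW: a => a s; elim/ringfracW: b => b t; elim/fracW: v => x r.
rewrite (fracscaleE b t x r) (fracscaleE a s (b *: x) _) (fracmulE a b s t).
rewrite (fracscaleE (a * b) _ x r).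
apply/mkfrac_eq; exists 1; rewrite ?rpred1 //= !scale1r !scalerA.
by congr (_ *: _); ring.
Qed.

Lemma fracscale1 v : fracscale (mkfrac (1 : A^o) (denom1 S)) v = v.
Proof.
elim/fracW: v => x r; rewrite (fracscaleE 1 _ x r).
by apply/mkfrac_eq; exists 1; rewrite ?rpred1 //= !scale1r mul1r.
Qed.

Lemma fracscaleDr a : {morph @fracscale A S M a : v w / v + w}.
Proof.
elim/ringfracW: a => a s; elim/fracW=> x t; elim/fracW=> y r.
rewrite addfracE (fracscaleE a s x t) (fracscaleE a s y r).
rewrite (fracscaleE a s (_ + _)) addfracE.
apply/mkfrac_eq; exists 1; rewrite ?rpred1 //= !scale1r !scalerDr !scalerA.
by congr (_ *: _ + _ *: _); ring.
Qed.

Lemma fracscaleDl v : {morph (@fracscale A S M)^~ v : a b / a + b}.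
Proof.
elim/fracW: v => x r; elim/ringfracW=> a s; elim/ringfracW=> b t.
rewrite addfracE (fracscaleE a s x r) (fracscaleE b t x r).
rewrite (fracscaleE (sval t * a + sval s * b) _ x r) addfracE.
apply/mkfrac_eq; exists 1; rewrite ?rpred1 //= !scale1r.
rewrite !(scalerDr, scalerDl) !scalerA.
by congr (_ *: _ + _ *: _); ring.
Qed.

End FracScaleTheory.

Section FracRing.
Variables (A : comPzRingType) (S : mulrClosed A).

Definition fracring := fracmod S A^o.
HB.instance Definition _ := GRing.Zmodule.on fracring.

Definition ringfrac (a : A) (t : denom S) : fracring := mkfrac (a : A^o) t.

Lemma fracringMC : commutative (@fracscale A S A^o).
Proof.
elim/fracW=> x s; elim/fracW=> y t; rewrite !fracscaleE.
by apply/mkfrac_eq; exists 1; rewrite ?rpred1 // /GRing.scale /=; ring.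
Qed.

HB.instance Definition _ := GRing.Zmodule_isComPzRing.Build fracring
  (@fracscaleA A S A^o) fracringMC (@fracscale1 A S A^o)
  (fun a b v => @fracscaleDl A S A^o v a b).

Lemma mulfracE a s b t :
  ringfrac a s * ringfrac b t = ringfrac (a * b) (denomM s t).
Proof. exact: fracscaleE. Qed.

Variable M : lmodType A.

HB.instance Definition _ := GRing.Zmodule_isLmodule.Build fracring (fracmod S M)
  (@fracscaleA A S M) (@fracscale1 A S M) (@fracscaleDr A S M)
  (@fracscaleDl A S M).

Lemma scalefracE a s (x : M) t :
  ringfrac a s *: (mkfrac x t : fracmod S M) = mkfrac (a *: x) (denomM s t).
Proof. exact: fracscaleE. Qed.

End FracRing.

Definition powers (A : comPzRingType) (s : A) : A -> bool :=
  fun x => `[< exists n, x = s ^+ n >].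

Lemma powers_mulr_closed (A : comPzRingType) (s : A) : mulr_closed (powers s).
Proof.
split=> [|x y /asboolP[m ->] /asboolP[n ->]]; apply/asboolP.
  by exists 0; rewrite expr0.
by exists (m + n)%N; rewrite exprD.
Qed.

HB.instance Definition _ (A : comPzRingType) (s : A) :=
  GRing.isMulClosed.Build A (powers s) (powers_mulr_closed s).

Definition powers_mon (A : comPzRingType) (s : A) : mulrClosed A :=
  GRing.MulClosed.clone A (powers s) _.

Notation locring s := (fracring (powers_mon s)).
Notation locmod s M := (fracmod (powers_mon s) M).

(* The library's [prime_idealr] and the ring structure on its ideal quotients
   require a nontrivial base ring; here the zero ring is allowed. *)
HB.mixin Record isPrimeIdeal (A : comPzRingType) (p : A -> bool) := {
  prime_ideal1 : 1 \notin p;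
  prime_idealMl : forall a u, u \in p -> a * u \in p;
  prime_ideal_prime : forall u v, u * v \in p -> (u \in p) || (v \in p)
}.

#[short(type="primeIdeal")]
HB.structure Definition PrimeIdeal (A : comPzRingType) :=
  {p of GRing.ZmodClosed A p & isPrimeIdeal A p}.

Section ResidueRing.
Variables (A : comPzRingType) (p : primeIdeal A).

Definition residue := Quotient.quot p.
HB.instance Definition _ := GRing.Zmodule.on residue.

Definition res (a : A) : residue := \pi_residue a.

Lemma resE x : res (repr x) = x. Proof. exact: reprK. Qed.

Lemma res_eq a b : (res a == res b) = (a - b \in p).
Proof. by rewrite Quotient.idealrBE. Qed.

Lemma resD a b : res a + res b = res (a + b).
Proof. by rewrite /res !piE. Qed.

Definition residue_mul (x y : residue) : residue := res (repr x * repr y).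

Lemma residue_mulE a b : residue_mul (res a) (res b) = res (a * b).
Proof.
apply/eqP; rewrite res_eq.
have ha : repr (res a) - a \in p by rewrite -res_eq resE.
have hb : repr (res b) - b \in p by rewrite -res_eq resE.
have -> : repr (res a) * repr (res b) - a * b =
  repr (res a) * (repr (res b) - b) + b * (repr (res a) - a) by ring.
by rewrite rpredD ?prime_idealMl.
Qed.

Lemma residue_mulA : associative residue_mul.
Proof.
by move=> x y z; rewrite -(resE x) -(resE y) -(resE z) !residue_mulE mulrA.
Qed.

Lemma residue_mulC : commutative residue_mul.
Proof. by move=> x y; rewrite -(resE x) -(resE y) !residue_mulE mulrC. Qed.

Lemma residue_mul1 : left_id (res 1) residue_mul.
Proof. by move=> x; rewrite -(resE x) residue_mulE mul1r. Qed.

Lemma residue_mulDl : left_distributive residue_mul +%R.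
Proof.
move=> x y z; rewrite -(resE x) -(resE y) -(resE z).
by rewrite !(residue_mulE, resD) mulrDl.
Qed.

Lemma res0 : res 0 = 0. Proof. by rewrite /res !piE. Qed.

Lemma res_eq0 a : (res a == 0) = (a \in p).
Proof. by rewrite -res0 res_eq subr0. Qed.

Lemma residue_1neq0 : res 1 != 0.
Proof. by rewrite res_eq0 prime_ideal1. Qed.

HB.instance Definition _ := GRing.Zmodule_isComNzRing.Build residue
  residue_mulA residue_mulC residue_mul1 residue_mulDl residue_1neq0.

Lemma resM a b : res a * res b = res (a * b).
Proof. exact: residue_mulE. Qed.

Definition residue_unit : pred residue := fun x => `[< exists y, y * x = 1 >].
Definition residue_inv (x : residue) : residue :=
  if pselect (exists y, y * x = 1) is left e then projT1 (cid e) else x.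

Lemma residue_mulVx : {in residue_unit, left_inverse 1 residue_inv *%R}.
Proof.
move=> x /asboolP e; rewrite /residue_inv.
by case: pselect => [e'|//]; case: (cid e').
Qed.

Lemma residue_unitP x y : y * x = 1 -> residue_unit x.
Proof. by move=> e; apply/asboolP; exists y. Qed.

Lemma residue_inv_out : {in [predC residue_unit], residue_inv =1 id}.
Proof.
move=> x /negP nu; rewrite /residue_inv; case: pselect => // e.
by case: nu; apply/asboolP.
Qed.

HB.instance Definition _ := GRing.ComNzRing_hasMulInverse.Build residue
  residue_mulVx residue_unitP residue_inv_out.

Lemma residue_integral (x y : residue) : x * y = 0 -> (x == 0) || (y == 0).
Proof.
rewrite -(resE x) -(resE y) resM => /eqP; rewrite !res_eq0.
exact: prime_ideal_prime.
Qed.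

HB.instance Definition _ :=
  GRing.ComUnitRing_isIntegral.Build residue residue_integral.

End ResidueRing.

Arguments residue {A} p.
Arguments res {A} p a.

Definition resfield (A : comPzRingType) (p : primeIdeal A) : fieldType :=
  {fraction residue p}.

Section Fibre.
Variables (A : comPzRingType) (p : primeIdeal A).

Definition prime_compl : A -> bool := fun x => x \notin p.

Lemma prime_compl_mulr_closed : mulr_closed prime_compl.
Proof.
split=> [|x y]; rewrite !unfold_in /prime_compl ?prime_ideal1 // => nx ny.
by apply/negP => /prime_ideal_prime /orP[]; apply/negP.
Qed.

HB.instance Definition _ :=
  GRing.isMulClosed.Build A prime_compl prime_compl_mulr_closed.

Definition compl_mon : mulrClosed A := GRing.MulClosed.clone A prime_compl _.

Variable L : lmodType A.

(* [prime_smul] is the submodule pL of L, and [quotmod] below is L/pL. *)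
Definition prime_smul : L -> bool := fun x =>
  `[< exists n (a : 'I_n -> A) (y : 'I_n -> L),
        (forall i, a i \in p) /\ x = \sum_(i < n) a i *: y i >].

Lemma prime_smul_zmod_closed : zmod_closed prime_smul.
Proof.
split=> [|x y /asboolP[m [a [u [pa ->]]]] /asboolP[n [b [v [pb ->]]]]].
  apply/asboolP; exists 0, (fun=> 0), (fun=> 0).
  by rewrite big_ord0; split=> [[]|].
apply/asboolP; exists (m + n)%N,
  (fun i => match split i with inl j => a j | inr k => - b k end),
  (fun i => match split i with inl j => u j | inr k => v k end); split.
  by move=> i; case: split => // k; rewrite rpredN.
rewrite big_split_ord /=; congr (_ + _).
  by apply: eq_bigr => i _; rewrite (unsplitK (inl i)).
rewrite -sumrN; apply: eq_bigr => i _.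
by rewrite (unsplitK (inr i)) scaleNr.
Qed.

HB.instance Definition _ :=
  GRing.isZmodClosed.Build L prime_smul prime_smul_zmod_closed.

Lemma prime_smulZ a x : x \in prime_smul -> a *: x \in prime_smul.
Proof.
move=> /asboolP[n [b [y [pb ->]]]]; apply/asboolP.
exists n, (fun i => a * b i), y; split=> [i|]; first exact: prime_idealMl.
by rewrite scaler_sumr; apply: eq_bigr => i _; rewrite scalerA.
Qed.

Lemma mem_prime_smul a x : a \in p -> a *: x \in prime_smul.
Proof.
move=> pa; apply/asboolP; exists 1, (fun=> a), (fun=> x).
by rewrite big_ord1; split.
Qed.

Definition quotmod := @Quotient.quot L (GRing.ZmodClosed.clone L prime_smul _).
HB.instance Definition _ := GRing.Zmodule.on quotmod.

Definition toquot (x : L) : quotmod := \pi_quotmod x.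

Lemma toquotE v : toquot (repr v) = v. Proof. exact: reprK. Qed.

Lemma toquot_eq x y : (toquot x == toquot y) = (x - y \in prime_smul).
Proof. by rewrite Quotient.idealrBE. Qed.

Lemma toquotD x y : toquot x + toquot y = toquot (x + y).
Proof. by rewrite /toquot !piE. Qed.

Definition quotmod_scale (a : A) (v : quotmod) : quotmod :=
  toquot (a *: repr v).

Lemma quotmod_scaleE a x : quotmod_scale a (toquot x) = toquot (a *: x).
Proof.
by apply/eqP; rewrite toquot_eq -scalerBr prime_smulZ // -toquot_eq toquotE.
Qed.

Lemma quotmod_scaleA a b v :
  quotmod_scale a (quotmod_scale b v) = quotmod_scale (a * b) v.
Proof. by rewrite -(toquotE v) !quotmod_scaleE scalerA. Qed.

Lemma quotmod_scale1 : left_id 1 quotmod_scale.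
Proof. by move=> v; rewrite -(toquotE v) !quotmod_scaleE scale1r. Qed.

Lemma quotmod_scaleDr : right_distributive quotmod_scale +%R.
Proof.
move=> a v w; rewrite -(toquotE v) -(toquotE w).
by rewrite !(quotmod_scaleE, toquotD) scalerDr.
Qed.

Lemma quotmod_scaleDl v : {morph quotmod_scale^~ v : a b / a + b}.
Proof.
by move=> a b; rewrite -(toquotE v) !(quotmod_scaleE, toquotD) scalerDl.
Qed.

HB.instance Definition _ := GRing.Zmodule_isLmodule.Build A quotmod
  quotmod_scaleA quotmod_scale1 quotmod_scaleDr quotmod_scaleDl.

Lemma scale_toquot a x : a *: toquot x = toquot (a *: x).
Proof. exact: quotmod_scaleE. Qed.

Lemma quotmod_kill a (v : quotmod) : a \in p -> a *: v = 0.
Proof.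
move=> pa; rewrite -(toquotE v) scale_toquot.
have <- : toquot 0 = 0 by rewrite /toquot !piE.
by apply/eqP; rewrite toquot_eq subr0 mem_prime_smul.
Qed.

Definition resfrac (a : A) (s : denom compl_mon) : resfield p :=
  FracField.tofrac (res p a) / FracField.tofrac (res p (sval s)).

Lemma res_denom_neq0 (s : denom compl_mon) : res p (sval s) != 0.
Proof. by rewrite res_eq0; apply: (svalP s). Qed.

Lemma repr_residue_compl (d : residue p) : d != 0 -> repr d \in compl_mon.
Proof. by rewrite -{1}(resE d) res_eq0. Qed.

Definition resnum (x : resfield p) : A := repr \n_(repr x).
Definition resden (x : resfield p) : denom compl_mon :=
  exist _ (repr \d_(repr x)) (repr_residue_compl (denom_ratioP (repr x))).

Lemma resfracE x : resfrac (resnum x) (resden x) = x.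
Proof.
rewrite /resfrac /= !resE; apply/eqP; rewrite -[eqbRHS]reprK eq_sym.
rewrite -(inj_eq (mulIf (_ : FracField.tofrac \d_(repr x) != 0))); last first.
  by rewrite tofrac_eq0 denom_ratioP.
rewrite divfK ?tofrac_eq0 ?denom_ratioP //.
have d0 := denom_ratioP (repr x).
unlock FracField.tofrac; rewrite -[_ * _]FracField.pi_mul.
apply/eqP/eqmodP; rewrite /= FracField.equivfE /FracField.mulf.
by rewrite !numden_Ratio ?mulr1 ?oner_eq0 // mulrC.
Qed.

Lemma resfrac_eq a s b t :
  resfrac a s = resfrac b t <-> a * sval t - b * sval s \in p.
Proof.
rewrite /resfrac -res_eq -!resM -tofrac_eq !tofracM.
by rewrite -eqr_div ?tofrac_eq0 ?res_denom_neq0 //; split=> /eqP.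
Qed.

Lemma resfracM a s b t :
  resfrac a s * resfrac b t = resfrac (a * b) (denomM s t).
Proof. by rewrite /resfrac /= -!resM !tofracM mulf_div. Qed.

Lemma resfracD a s b t :
  resfrac a s + resfrac b t =
  resfrac (sval t * a + sval s * b) (denomM s t).
Proof.
rewrite /resfrac /= -resD -!resM tofracD !tofracM.
rewrite addf_div ?tofrac_eq0 ?res_denom_neq0 //.
by rewrite [_ * FracField.tofrac (res p (sval t))]mulrC
  [FracField.tofrac (res p b) * _]mulrC.
Qed.

Lemma resfrac1 : resfrac 1 (denom1 _) = 1.
Proof. by rewrite /resfrac /= divff // tofrac_eq0 oner_eq0. Qed.

Lemma resfracW (P : resfield p -> Prop) :
  (forall a s, P (resfrac a s)) -> forall x, P x.
Proof. by move=> h x; rewrite -(resfracE x). Qed.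

(* The localization (L/pL)_p with its action of the residue field, given by
   a/s *: v/t = (a *: v)/(s * t): see [scale_resfrac] below. *)
Definition fibre := fracmod compl_mon quotmod.
HB.instance Definition _ := GRing.Zmodule.on fibre.

Definition fibre_scale (x : resfield p) (v : fibre) : fibre :=
  ringfrac (resnum x) (resden x) *: (v : fracmod compl_mon quotmod).

Lemma fibre_scaleE a s (v : quotmod) t :
  fibre_scale (resfrac a s) (mkfrac v t) = mkfrac (a *: v) (denomM s t).
Proof.
have /resfrac_eq := resfracE (resfrac a s).
rewrite /fibre_scale scalefracE; move: (resnum _) (resden _) => b r h.
apply/mkfrac_eq; exists 1; rewrite ?rpred1 //.
rewrite !scale1r /=; apply/eqP; rewrite -subr_eq0 !scalerA -scalerBl.
rewrite [X in X *: _](_ : _ = sval t * (b * sval s - a * sval r)); last ring.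
by rewrite quotmod_kill // prime_idealMl.
Qed.

Lemma fibre_scaleA x y v :
  fibre_scale x (fibre_scale y v) = fibre_scale (x * y) v.
Proof.
elim/resfracW: x => a s; elim/resfracW: y => b t; elim/fracW: v => x r.
rewrite resfracM (fibre_scaleE b t x r) (fibre_scaleE a s (b *: x)).
rewrite (fibre_scaleE (a * b) _ x r).
apply/mkfrac_eq; exists 1; rewrite ?rpred1 //= !scale1r !scalerA.
by congr (_ *: _); ring.
Qed.

Lemma fibre_scale1 : left_id 1 fibre_scale.
Proof.
elim/fracW=> x r; rewrite -resfrac1 (fibre_scaleE 1 _ x r).
by apply/mkfrac_eq; exists 1; rewrite ?rpred1 //= !scale1r mul1r.
Qed.

Lemma fibre_scaleDr : right_distributive fibre_scale +%R.
Proof.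
move=> x v w; exact: scalerDr.
Qed.

Lemma fibre_scaleDl v : {morph fibre_scale^~ v : x y / x + y}.
Proof.
elim/fracW: v => x r; elim/resfracW=> a s; elim/resfracW=> b t.
rewrite resfracD (fibre_scaleE a s x r) (fibre_scaleE b t x r).
rewrite (fibre_scaleE _ _ x r) addfracE.
apply/mkfrac_eq; exists 1; rewrite ?rpred1 //= !scale1r.
rewrite !(scalerDr, scalerDl) !scalerA.
by congr (_ *: _ + _ *: _); ring.
Qed.

HB.instance Definition _ := GRing.Zmodule_isLmodule.Build (resfield p) fibre
  fibre_scaleA fibre_scale1 fibre_scaleDr fibre_scaleDl.

Lemma scale_resfrac a s (v : quotmod) t :
  resfrac a s *: (mkfrac v t : fibre) = mkfrac (a *: v) (denomM s t).
Proof. exact: fibre_scaleE. Qed.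

End Fibre.

Arguments quotmod {A} p L.
Arguments fibre {A} p L.

Section Invertible.
Variable A : comPzRingType.

(* For [M := A^o] this says that the sum of the ideals [A s_i] is [A]. *)
Definition generates (M : lmodType A) n (s : 'I_n -> M) : Prop :=
  forall x : M, exists c : 'I_n -> A, x = \sum_(i < n) c i *: s i.

Definition finitely_generated (M : lmodType A) : Prop :=
  exists n (s : 'I_n -> M), generates s.

Definition projective (L : lmodType A) : Prop :=
  forall (M N : lmodType A) (g : {linear M -> N}) (f : {linear L -> N}),
    (forall y, exists x, g x = y) ->
    exists h : {linear L -> M}, forall x, g (h x) = f x.

(* [Vector.axiom n V] is a linear isomorphism from [V] to ['rV_n]; it is the
   data making [V] a [vectType] of dimension [n]. *)
Definition has_dim (K : fieldType) (V : lmodType K) (n : nat) : Prop :=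
  inhabited (Vector.axiom n V).

Definition has_rank (L : lmodType A) (n : nat) : Prop :=
  forall p : primeIdeal A, has_dim (fibre p L : lmodType (resfield p)) n.

Definition invertible (L : lmodType A) : Prop :=
  [/\ projective L, finitely_generated L & has_rank L 1].

End Invertible.

Definition lmod_iso (R : pzRingType) (M N : lmodType R) : Prop :=
  exists f : {linear M -> N}, bijective f.

(* Main.v *)
Require Import Defs.
From HB Require Import structures.
From mathcomp Require Import all_boot all_algebra.
From mathcomp Require Import ring boolp classical_sets.

(* Both conditions are equivalent to the existence, for every prime p, of
   t outside p, x in L and a linear form phi on L with phi x = t and
   t y = phi(y) x for all y: then x/1 is a basis of L_t, and since the t
   generate the unit ideal, finitely many of them give a dual basis of L.

   If L is invertible, take a dual basis (x_k, phi_k) and i, j with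
   s = phi_j(x_i) outside p.  The fibre being a line, all 2x2 minors
   phi(y) psi(z) - phi(z) psi(y) lie in p, so that multiplication by s on the
   elements y_k = s x_k - phi_j(x_k) x_i has a matrix with entries in p; the
   determinant trick then gives u outside p killing every y_k, whence the frame
   (u s, x_i, u phi_j).

   If each L_{s_i} is free on x_i/1, the x_i generate L, and s_i^N x_k = a_ik x_i
   for some N and a_ik.  The finitely many relations s_i^N e_k - a_ik e_i
   generate all relations between the x_k, hence a single power of s_i makes
   x_k |-> s_i^m a_ik well defined on L. *)

Set Implicit Arguments.
Unset Strict Implicit.
Unset Printing Implicit Defensive.

Import GRing.Theory.
Local Open Scope ring_scope.

(** * Submodules, prime ideals and the local-global principle *)

Section LocalGlobal.
Variable A : comPzRingType.

Definition submod (V : lmodType A) (P : V -> Prop) : Prop :=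
  P 0 /\ forall a x y, P x -> P y -> P (a *: x + y).

Section Submod.
Variables (V : lmodType A) (P : V -> Prop).
Hypothesis subP : submod P.

Lemma submodZ a x : P x -> P (a *: x).
Proof.
by move=> Px; rewrite -[_ *: _]addr0; apply: subP.2 => //; exact: subP.1.
Qed.

Lemma submodD x y : P x -> P y -> P (x + y).
Proof. by move=> Px Py; rewrite -[x]scale1r; apply: subP.2. Qed.

Lemma submod_sum (T : finType) (x : T -> V) :
  (forall i, P (x i)) -> P (\sum_i x i).
Proof. by move=> Px; elim/big_ind: _ => //; [exact: subP.1|exact: submodD]. Qed.

End Submod.

(** If [u * v] lies in [P] and [u] does not, maximality forces [1 = b + c * u] with [b] in [P];
    multiplying by [v] puts [v] in [P]. *)
Lemma maximal_ideal_prime (P : A -> Prop) :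
  @submod A^o P -> ~ P 1 ->
  (forall Q, @submod A^o Q -> ~ Q 1 -> (forall a, P a -> Q a) ->
     forall a, Q a -> P a) ->
  exists p : primeIdeal A, forall a, (a \in p) = `[< P a >].
Proof.
move=> idP P1 maxP; pose q : A -> bool := fun a => `[< P a >].
have qE a : (a \in q) = `[< P a >] by [].
have qZ : zmod_closed q.
  split=> [|x y]; first by rewrite qE; apply/asboolP; exact: idP.1.
  rewrite !qE => /asboolP Px /asboolP Py; apply/asboolP.
  by rewrite addrC -mulN1r; exact: (idP.2 (-1) y x).
have q1 : 1 \notin q by rewrite qE; apply/asboolP.
have qM a u : u \in q -> a * u \in q.
  by rewrite !qE => /asboolP Pu; apply/asboolP; exact: (submodZ idP a).
have qp u v : u * v \in q -> (u \in q) || (v \in q).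
  rewrite !qE => /asboolP Puv; apply/orP.
  have [Pu|nPu] := pselect (P u); [by left; apply/asboolP|right; apply/asboolP].
  pose Q a := exists b c, P b /\ a = b + c * u.
  have idQ : @submod A^o Q.
    split=> [|a _ _ [b [c [Pb ->]]] [d [e [Pd ->]]]].
      by exists 0, 0; rewrite mul0r addr0; split=> //; exact: idP.1.
    exists (a * b + d), (a * c + e); split; first exact: idP.2.
    by rewrite /GRing.scale /=; ring.
  have PQ a : P a -> Q a by exists a, 0; rewrite mul0r addr0.
  have [[b [c [Pb e1]]]|nQ1] := pselect (Q 1); last first.
    case: nPu; apply: (maxP _ idQ nQ1 PQ); exists 0, 1.
    by rewrite add0r mul1r; split=> //; exact: idP.1.
  have -> : v = v * b + c * (u * v) by rewrite -[LHS]mul1r e1; ring.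
  by apply: (submodD idP); apply: (submodZ idP).
pose H1 := GRing.isZmodClosed.Build A q qZ.
pose H2 := isPrimeIdeal.Build A q q1 qM qp.
pose p : primeIdeal A := HB.pack q H1 H2.
by exists p.
Qed.

Lemma proper_ideal_prime (I : A -> Prop) :
  @submod A^o I -> ~ I 1 -> exists p : primeIdeal A, forall a, I a -> a \in p.
Proof.
move=> idI I1.
(* Zorn's lemma also asks for the union of the empty chain; joining [I] to [X] makes the empty set
   good. *)
pose good (X : set A) := @submod A^o (I `|` X)%classic /\ ~ (I `|` X)%classic 1.
have [F goodF totF|M [[idM M1] maxM]] := @Zorn_bigcup A good.
  split=> [|[//|[X FX X1]]]; last by case: (goodF X FX) => _; apply; right.
  split=> [|a x y]; first by left; exact: idI.1.
  move=> [Ix|[X FX Xx]] [Iy|[Y FY Yy]].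
  - by left; apply: idI.2.
  - case: ((goodF Y FY).1.2 a x y _ _) => [||?|?]; [by left|by right|by left|].
    by right; exists Y.
  - case: ((goodF X FX).1.2 a x y _ _) => [||?|?]; [by right|by left|by left|].
    by right; exists X.
  - wlog XY : / exists2 Z, F Z & Z x /\ Z y.
      apply; case: (totF X Y FX FY) => [XY|YX].
        by exists Y => //; split=> //; exact: XY.
      by exists X => //; split=> //; exact: YX.
    case: XY => Z FZ [Zx Zy].
    case: ((goodF Z FZ).1.2 a x y _ _) => [||?|?]; [by right|by right|by left|].
    by right; exists Z.
have [Q idQ Q1 MQ a Qa|p pE] := maximal_ideal_prime idM M1.
  right; apply: contrapT => nMa; apply: (maxM Q).
    by split=> [b Mb|QM]; [apply: MQ; right|apply/nMa/QM].
  suff IQ : (I `|` Q)%classic = Q by rewrite /good IQ.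
  by apply/setUidPr => b Ib; apply: MQ; left.
by exists p => a Ia; rewrite pE; apply/asboolP; left.
Qed.

(** The [a] with [P (a *: x)] form an ideal; were it proper, it would lie in a prime, against the
    hypothesis at that prime. *)
Lemma submod_local (V : lmodType A) (P : V -> Prop) (x : V) :
  submod P -> (forall p : primeIdeal A, exists2 a, a \notin p & P (a *: x)) ->
  P x.
Proof.
move=> subP loc; rewrite -[x]scale1r; apply: contrapT => nP1.
have idI : @submod A^o (fun a => P (a *: x)).
  split=> [|a b c Pb Pc]; first by rewrite scale0r; exact: subP.1.
  by rewrite scalerDl -scalerA; apply: subP.2.
have [p Ip] := proper_ideal_prime idI nP1.
by have [a /negP na /Ip] := loc p.
Qed.

Definition spanned (T : finType) (V : lmodType A) (x : T -> V) (v : V) : Prop :=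
  exists c : T -> A, v = \sum_i c i *: x i.

Lemma submod_spanned (T : finType) (V : lmodType A) (x : T -> V) :
  submod (spanned x).
Proof.
split=> [|a _ _ [c ->] [d ->]].
  by exists (fun=> 0); rewrite big1 // => i _; rewrite scale0r.
exists (fun i => a * c i + d i); rewrite scaler_sumr -big_split /=.
by apply: eq_bigr => i _; rewrite scalerDl scalerA.
Qed.

Lemma mem_spanned (T : finType) (V : lmodType A) (x : T -> V) i :
  spanned x (x i).
Proof.
exists (fun j => (j == i)%:R).
rewrite (bigD1 i) //= eqxx scale1r big1 ?addr0 //.
by move=> j /negbTE ->; rewrite scale0r.
Qed.

Definition unimodular (T : finType) (s : T -> A) : Prop :=
  spanned (s : T -> A^o) 1.

Lemma unimodularP (T : finType) (s : T -> A) :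
  unimodular s <-> forall p : primeIdeal A, exists i, s i \notin p.
Proof.
split=> [[c e1] p|loc].
  apply: contrapT => /forallNP sp; case/negP: (prime_ideal1 (s := p)).
  rewrite e1; apply: rpred_sum => i _; apply: prime_idealMl.
  by apply/negPn/negP; exact: sp.
apply: (@submod_local A^o); first exact: submod_spanned.
move=> p; have [i nsi] := loc p; exists (s i) => //.
by rewrite [_ *: _]mulr1; exact: mem_spanned.
Qed.

Lemma prime_idealX (p : primeIdeal A) a n : a \notin p -> a ^+ n \notin p.
Proof.
move=> na; elim: n => [|n IHn]; first by rewrite expr0 prime_ideal1.
by rewrite exprS; apply/negP => /prime_ideal_prime /orP[]; apply/negP.
Qed.

End LocalGlobal.

(** The combinations of finite families with members in [Q] form an ideal, families being
    concatenated over a sum type; the local-global principle puts 1 in it. *)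
Lemma prime_cover (A : comPzRingType) (Q : A -> Prop) :
  (forall p : primeIdeal A, exists2 a, a \notin p & Q a) ->
  exists (T : finType) (t : T -> A), unimodular t /\ forall i, Q (t i).
Proof.
move=> loc; pose P (a : A^o) := exists (T : finType) (t : T -> A),
  spanned (t : T -> A^o) a /\ forall i, Q (t i).
suff [T [t [t1 Qt]]] : P 1 by exists T, t.
apply: (@submod_local A A^o) => [|p]; last first.
  have [a na Qa] := loc p; exists a => //; exists unit, (fun=> a); split=> //.
  by rewrite [_ *: _]mulr1; exact: (mem_spanned (fun=> a : A^o) tt).
split=> [|a _ _ [T [t [[c ->] Qt]]] [T' [t' [[c' ->] Qt']]]].
  by exists void, (of_void A); split; [exact: (submod_spanned _).1|case].
exists (T + T')%type, (fun i => match i with inl j => t j | inr j => t' j end).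
split; last by case.
exists (fun i => match i with inl j => a * c j | inr j => c' j end).
rewrite big_sumType /= scaler_sumr; congr (_ + _).
by apply: eq_bigr => i _; rewrite scalerA.
Qed.

Lemma linear_ex (R : pzRingType) (U V : lmodType R) (f : U -> V) :
  linear f -> exists g : {linear U -> V}, g =1 f.
Proof.
move=> linf; pose H := GRing.isLinear.Build R U V *:%R f linf.
by exists (HB.pack f H : {linear U -> V}).
Qed.

(** * Local frames, and how they make [L] invertible and locally free *)

Section LocalFrame.
Variables (A : comPzRingType) (L : lmodType A).

Lemma powersX (t : A) n : t ^+ n \in powers_mon t.
Proof. by apply/asboolP; exists n. Qed.

Lemma powers_id (t : A) : t \in powers_mon t.
Proof. exact: (powersX t 1). Qed.

Lemma powersP (t u : A) : u \in powers_mon t -> exists n, u = t ^+ n.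
Proof. by move/asboolP. Qed.

(** The form [phi] is [t] times the coordinate along [x]: in [L_t], [y/1] is [phi(y)/t] times
    [x/1]. *)
Definition local_frame (t : A) (x : L) (phi : {linear L -> A^o}) : Prop :=
  phi x = t /\ forall y, t *: y = phi y *: x.

Lemma linearZo (phi : {linear L -> A^o}) a y : phi (a *: y) = a * phi y :> A.
Proof. by rewrite linearZ. Qed.

Lemma local_frame_iso t x phi : local_frame t x phi ->
  lmod_iso (locring t)^o (locmod t L).
Proof.
move=> [phix tE]; pose v : locmod t L := mkfrac x (denom1 (powers_mon t)).
have [f fE] : exists f : {linear (locring t)^o -> locmod t L},
    f =1 fun a : locring t => a *: v.
  by apply: linear_ex => a b c /=; rewrite scalerDl scalerA.
pose td : denom (powers_mon t) := exist _ t (powers_id t).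
(* The inverse sends [y/r] to [phi(y)/(t r)]; it is computed on chosen representatives, which
   [mkfracK] compares with [y] and [r]. *)
exists f; exists (fun w =>
    ringfrac (phi (fracnum w) : A) (denomM td (fracden w)) : (locring t)^o).
- elim/ringfracW=> a r; rewrite fE /v [_ *: _]scalefracE.
  have [u tu /= e] := mkfracK (a *: x) (denomM r (denom1 (powers_mon t))).
  apply/mkfrac_eq; exists u => //=.
  move/(congr1 phi): e; rewrite !linearZo phix mulr1 /GRing.scale /= => ->.
  by ring.
- elim/fracW=> y r; rewrite fE /v [_ *: _]scalefracE.
  have [u tu /= e] := mkfracK y r.
  apply/mkfrac_eq; exists u => //=; rewrite -tE.
  transitivity (t *: (u *: (sval r *: fracnum (mkfrac y r)))).
    by rewrite !scalerA; congr (_ *: _); ring.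
  by rewrite e !scalerA; congr (_ *: _); ring.
Qed.

Lemma linear_prime_smul (p : primeIdeal A) (phi : {linear L -> A^o}) (y : L) :
  y \in @prime_smul A p L -> (phi y : A) \in p.
Proof.
move=> /asboolP[n [a [z [pa ->]]]]; rewrite linear_sum.
apply: rpred_sum => i _; rewrite linearZo mulrC; exact: prime_idealMl.
Qed.

Lemma toquot0 (p : primeIdeal A) : toquot p (0 : L) = 0.
Proof. by rewrite /toquot !piE. Qed.

Lemma toquot_eq0 (p : primeIdeal A) (y : L) :
  (toquot p y == 0) = (y \in @prime_smul A p L).
Proof. by rewrite -toquot0 toquot_eq subr0. Qed.

Lemma fibreW (p : primeIdeal A) (P : fibre p L -> Prop) :
  (forall (y : L) r, P (mkfrac (toquot p y) r)) -> forall v, P v.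
Proof. by move=> h; elim/fracW=> y r; rewrite -(toquotE y). Qed.

Lemma fibre_eqP (p : primeIdeal A) (y z : L) r s :
  mkfrac (toquot p y) r = mkfrac (toquot p z) s :> fibre p L <->
  exists2 u, u \notin p & u *: (sval s *: y - sval r *: z) \in @prime_smul A p L.
Proof.
have scaleE u : (u *: (sval s *: toquot p y) == u *: (sval r *: toquot p z)) =
    (u *: (sval s *: y - sval r *: z) \in @prime_smul A p L).
  rewrite !(scale_toquot p _ y, scale_toquot p _ z) !(scale_toquot p u).
  by rewrite toquot_eq -scalerBr.
split=> [/mkfrac_eq[u nu /eqP e]|[u nu e]].
  by exists u; rewrite -?scaleE.
by apply/(@mkfrac_eq A _ (quotmod p L)); exists u => //; apply/eqP; rewrite scaleE.
Qed.

Lemma local_frame_fibre t x phi (p : primeIdeal A) :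
  local_frame t x phi -> t \notin p ->
  has_dim (fibre p L : lmodType (resfield p)) 1.
Proof.
move=> [phix tE] nt.
pose psi (y : L) : A := phi y.
(* The coordinate of [y/r] is [phi(y)/r], independent of the representative because a linear form
   maps [pL] into [p]. The basis vector is [x/t], of coordinate [t/t = 1]. *)
pose f (v : fibre p L) : 'rV[resfield p]_1 :=
  const_mx (resfrac (psi (repr (fracnum v))) (fracden v)).
have fE y r : f (mkfrac (toquot p y) r) = const_mx (resfrac (psi y) r).
  rewrite /f; congr const_mx; apply/resfrac_eq.
  have := fracE (mkfrac (toquot p y) r).
  rewrite -[X in mkfrac X]toquotE => /fibre_eqP[u nu].
  move/(linear_prime_smul phi).
  rewrite linearZo linearB /= !linearZo => /prime_ideal_prime.
  by rewrite (negbTE nu) /= ![_ * sval _]mulrC.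
pose td : denom (compl_mon p) := exist _ t nt.
pose g (c : 'rV[resfield p]_1) : fibre p L :=
  c 0 0 *: (mkfrac (toquot p x) td : fibre p L).
constructor; exists f.
  move=> a v w; elim/resfracW: a => a s.
  elim/fibreW: v => y r; elim/fibreW: w => z q.
  rewrite scale_resfrac scale_toquot [_ + _]addfracE !scale_toquot toquotD.
  rewrite !fE; apply/matrixP=> i j; rewrite !mxE.
  rewrite resfracM resfracD /=; congr resfrac.
  by rewrite /psi linearD !linearZo.
exists g.
  elim/fibreW=> y r; rewrite fE /g mxE scale_resfrac scale_toquot -tE.
  apply/fibre_eqP; exists 1; first exact: prime_ideal1.
  rewrite scale1r /= scalerA [sval r * _]mulrC subrr.
  by rewrite -(toquot_eq0 p) toquot0.
move=> c; rewrite /g; apply/matrixP=> i j; rewrite !ord1.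
elim/resfracW: (c 0 0) => a r; rewrite scale_resfrac scale_toquot fE mxE.
apply/resfrac_eq; rewrite /psi linearZo phix /=.
by rewrite (_ : _ - _ = 0) ?rpred0 //; ring.
Qed.

(** To lift [f] through [g], lift the finitely many [f (x i)] and recombine the lifts with the
    coordinates [phi i]. *)
Lemma dual_basis_projective (T : finType) (x : T -> L)
    (phi : T -> {linear L -> A^o}) :
  (forall y, y = \sum_i (phi i y : A) *: x i) -> projective L.
Proof.
move=> dual M N g f gsurj.
have /choice[z gz] i : exists z, g z = f (x i) by exact: gsurj.
have [h hE] : exists h : {linear L -> M},
    h =1 fun y => \sum_i (phi i y : A) *: z i.
  apply: linear_ex => a y y'; rewrite scaler_sumr -big_split /=.
  by apply: eq_bigr => i _; rewrite linearP scalerDl scalerA.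
exists h => y; rewrite hE [in RHS](dual y) !linear_sum; apply: eq_bigr => i _.
by rewrite !linearZ /= gz.
Qed.

Definition locally_framed : Prop :=
  forall p : primeIdeal A, exists2 t, t \notin p &
    exists x phi, local_frame t x phi.

Lemma locally_framed_cover : locally_framed ->
  exists (T : finType) (t : T -> A) (x : T -> L) (phi : T -> {linear L -> A^o}),
    unimodular t /\ forall i, local_frame (t i) (x i) (phi i).
Proof.
move=> /prime_cover[T [t [t1 /choice[x /choice[phi frame]]]]].
by exists T, t, x, phi.
Qed.

Lemma spanned_finitely_generated (T : finType) (x : T -> L) :
  (forall y, spanned x y) -> finitely_generated L.
Proof.
move=> gen; exists #|T|, (x \o enum_val) => y; have [c ->] := gen y.
exists (c \o enum_val); rewrite (reindex (@enum_val T T)) //=.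
exact/onW_bij/enum_val_bij.
Qed.

Lemma locally_framed_invertible : locally_framed -> invertible L.
Proof.
move=> /locally_framed_cover[T [t [x [phi [tP frame]]]]].
have [d d1] := tP.
(* Expand [1 = \sum_i d i * t i] and apply each frame: the forms [d i * phi i] are dual to the
   [x i]. *)
have dual y : y = \sum_i (d i * phi i y) *: x i.
  rewrite -[LHS]scale1r d1 scaler_suml; apply: eq_bigr => i _.
  by rewrite -!scalerA (frame i).2.
split.
- have /choice[psi psiE] i : exists psi : {linear L -> A^o},
      psi =1 fun y => d i * phi i y.
    by apply: linear_ex => a y z; rewrite linearP /GRing.scale /=; ring.
  apply: (dual_basis_projective (x := x) (phi := psi)) => y.
  by rewrite [LHS]dual; apply: eq_bigr => i _; rewrite psiE.
- apply: (spanned_finitely_generated (x := x)) => y.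
  by exists (fun i => d i * phi i y).
- move=> p; have [i nti] := (unimodularP t).1 tP p.
  exact: (local_frame_fibre (frame i)).
Qed.

Lemma locally_framed_locally_free : locally_framed ->
  exists n (s : 'I_n -> A), generates (s : 'I_n -> A^o) /\
    forall i : 'I_n, lmod_iso (locring (s i))^o (locmod (s i) L).
Proof.
move=> /locally_framed_cover[T [t [x [phi [[d d1] frame]]]]].
exists #|T|, (t \o enum_val); split.
  move=> a; exists (fun i => a * d (enum_val i)).
  transitivity (a *: \sum_i d i *: (t i : A^o)).
    by rewrite -d1 [_ *: _]mulr1.
  rewrite scaler_sumr (reindex (@enum_val T T)) /=; last first.
    exact/onW_bij/enum_val_bij.
  by apply: eq_bigr => i _; rewrite scalerA.
by move=> i; apply: local_frame_iso (frame (enum_val i)).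
Qed.

End LocalFrame.

Lemma uniform_bound (T : finType) (Q : T -> nat -> Prop) :
  (forall i m n, Q i m -> Q i (n + m)%N) -> (forall i, exists m, Q i m) ->
  exists m, forall i, Q i m.
Proof.
move=> mono /choice[m Qm]; exists (\max_i m i) => i.
by rewrite -(subnK (leq_bigmax i)); exact: mono.
Qed.

(** * Generators of the localizations and the relations between them *)

Section LocalGenerator.
Variables (A : comPzRingType) (L : lmodType A).

(** The two clauses express, without denominators, that [a |-> a x/1] from [A_s] to [L_s] is onto
    and injective. *)
Definition local_generator (s : A) (x : L) : Prop :=
  (forall y, exists m a, s ^+ m *: y = a *: x) /\
  (forall a, a *: x = 0 -> exists m, s ^+ m * a = 0).

(** The numerator of [f 1 = x/r] serves, since [r], a power of [s], is invertible in [A_s]. *)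
Lemma iso_local_generator s : lmod_iso (locring s)^o (locmod s L) ->
  exists x, local_generator s x.
Proof.
move=> [f [g fK gK]]; set x := fracnum (f 1); set r := fracden (f 1).
have fE a t : f (ringfrac a t) = mkfrac (a *: x) (denomM t r).
  by rewrite -[ringfrac a t]mulr1 linearZ -(fracE (f 1)) [LHS]scalefracE.
exists x; split=> [y|a ax0].
  have [a [t]] : exists a t, g (mkfrac y (denom1 _)) = ringfrac a t.
    by elim/ringfracW: (g _) => a t; exists a, t.
  move/(congr1 f); rewrite gK fE => /mkfrac_eq[u /powersP[m ->]].
  have [n rtE] := powersP (svalP (denomM t r)).
  rewrite /= scale1r scalerA => e; exists (m + n)%N, (s ^+ m * a).
  by rewrite exprD -rtE -[RHS]scalerA -e -scalerA.
have : ringfrac a (denom1 (powers_mon s)) = 0.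
  apply: (can_inj fK); rewrite fE ax0 linear0.
  by apply/mkfrac_eq; exists 1; rewrite ?rpred1 // !scaler0.
move=> /mkfrac_eq[u /powersP[m ->]] /=.
by rewrite !scaler0 scale1r => e; exists m.
Qed.

Section Presentation.
Variables (T : finType) (x : T -> L).
Implicit Types c : {ffun T -> A^o}.

Definition lincomb c : L := \sum_i (c i : A) *: x i.

Lemma lincomb_linear : linear lincomb.
Proof.
move=> a c d; rewrite scaler_sumr -big_split; apply: eq_bigr => i _ /=.
by rewrite !ffunE scalerDl scalerA.
Qed.

HB.instance Definition _ :=
  GRing.isLinear.Build A {ffun T -> A^o} L *:%R lincomb lincomb_linear.

Definition unit_vec (i : T) : {ffun T -> A^o} := [ffun j => (j == i)%:R].

Lemma lincomb_unit i : lincomb (unit_vec i) = x i.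
Proof.
rewrite /lincomb (bigD1 i) //= ffunE eqxx scale1r big1 ?addr0 // => j.
by move=> /negbTE ne; rewrite ffunE ne scale0r.
Qed.

Lemma unit_vec_sum c : c = \sum_i (c i : A) *: unit_vec i.
Proof.
apply/ffunP => j; rewrite sum_ffunE (bigD1 j) //= !ffunE eqxx.
rewrite [_ *: _]mulr1 big1 ?addr0 // => i ne.
by rewrite !ffunE eq_sym (negbTE ne) scaler0.
Qed.

Hypothesis gen : forall y, spanned x y.

Lemma lincomb_surj y : exists c, lincomb c = y.
Proof.
have [c ->] := gen y; exists [ffun i => c i].
by apply: eq_bigr => i _; rewrite ffunE.
Qed.

Lemma uniform_coord s x0 : local_generator s x0 ->
  exists N (a : T -> A), forall i, s ^+ N *: x i = a i *: x0.
Proof.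
move=> [sgen _]; suff [N /choice[a aE]] : exists N, forall i,
    exists a, s ^+ N *: x i = a *: x0 by exists N, a.
apply: uniform_bound => [i m n [a e]|i]; last exact: sgen.
by exists (s ^+ n * a); rewrite exprD -!scalerA e.
Qed.

Lemma scale_lincomb s N (a : T -> A) x0 c :
  (forall i, s ^+ N *: x i = a i *: x0) ->
  s ^+ N *: lincomb c = (\sum_i c i * a i) *: x0.
Proof.
move=> aE; rewrite scaler_sumr scaler_suml; apply: eq_bigr => i _.
by rewrite scalerA mulrC -!scalerA aE.
Qed.

(** A relation [c] gives [(\sum_i c i * a i) *: x j = 0], so some [s ^+ m] kills this coefficient.
    In the combination with coefficients [s ^+ m * c i], the multiples of [unit_vec j] then add up
    to 0. *)
Lemma local_relation s N (a : T -> A) j c :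
  local_generator s (x j) -> (forall i, s ^+ N *: x i = a i *: x j) ->
  lincomb c = 0 ->
  exists m, spanned (fun i => s ^+ N *: unit_vec i - a i *: unit_vec j)
                    (s ^+ m *: c).
Proof.
move=> [_ sfree] aE c0; have [|m e] := sfree (\sum_i c i * a i).
  by rewrite -(scale_lincomb c aE) c0 scaler0.
exists (m + N)%N, (fun i => s ^+ m * c i).
transitivity (s ^+ (m + N) *: c - (s ^+ m * \sum_i c i * a i) *: unit_vec j).
  by rewrite e scale0r subr0.
rewrite [X in _ *: X - _](unit_vec_sum c) mulr_sumr scaler_suml.
rewrite scaler_sumr -sumrB.
apply: eq_bigr => i _; rewrite scalerBr !scalerA.
by congr (_ *: _ - _ *: _); rewrite ?exprD; ring.
Qed.

(** The form [b] on the free module satisfies [s ^+ N *: lincomb c = b c *: x0]; it descends to [L]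
    once multiplied by a power of [s] that kills its values on all relations. *)
Lemma local_generator_frame (E : finType) (r : E -> {ffun T -> A^o}) s x0 :
  (forall e, lincomb (r e) = 0) -> (forall c, lincomb c = 0 -> spanned r c) ->
  local_generator s x0 -> exists m phi, local_frame (s ^+ m) x0 phi.
Proof.
move=> r0 rel loc; have [N [a aE]] := uniform_coord loc.
have [sgen sfree] := loc; pose b c := \sum_i (c i : A) * a i.
have bD u c d : b (u *: c + d) = u * b c + b d.
  rewrite mulr_sumr -big_split; apply: eq_bigr => i _ /=.
  by rewrite !ffunE /GRing.scale /=; ring.
(* One exponent works for all generating relations because [E] is finite. *)
have [K rK] : exists K, forall e, s ^+ K * b (r e) = 0.
  apply: uniform_bound => [e m n em|e]; first by rewrite exprD -mulrA em mulr0.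
  by apply: sfree; rewrite -(scale_lincomb _ aE) r0 scaler0.
have bK c : lincomb c = 0 -> s ^+ K * b c = 0.
  move=> /rel[d ->]; elim/big_ind: _ => [|c1 c2 e1 e2|e _].
  - by rewrite /b big1 ?mulr0 // => i _; rewrite ffunE mul0r.
  - by rewrite -[c1]scale1r bD mulrDr mul1r e1 e2 addr0.
  - rewrite -[_ *: _]addr0 bD mulrDr mulrCA rK mulr0 add0r.
    by rewrite /b big1 ?mulr0 // => i _; rewrite ffunE mul0r.
have bKE c d : lincomb c = lincomb d -> s ^+ K * b c = s ^+ K * b d.
  move=> e; have : s ^+ K * b (-1 *: d + c) = 0.
    by apply: bK; rewrite linearP /= e scaleN1r addNr.
  by rewrite bD mulN1r mulrDr mulrN addrC => /subr0_eq.
have /choice[coord coordE] := lincomb_surj.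
pose psi y := s ^+ K * b (coord y).
have psiE y : psi y *: x0 = s ^+ (K + N) *: y.
  by rewrite /psi -scalerA -(scale_lincomb _ aE) coordE scalerA exprD.
(* The values [psi x0] and [s ^+ (K + N)] are only known to agree after scaling [x0]; a further
   power [s ^+ m] makes them equal. *)
have [|m sm] := sfree (psi x0 - s ^+ (K + N)).
  by rewrite scalerBl psiE subrr.
have [phi phiE] : exists phi : {linear L -> A^o},
    phi =1 fun y => s ^+ m * psi y.
  apply: linear_ex => u y z; rewrite /psi.
  rewrite (bKE _ (u *: coord y + coord z)) ?bD ?linearP /= ?coordE //.
  by rewrite /GRing.scale /=; ring.
exists (m + (K + N))%N, phi; split=> [|y].
  by rewrite phiE exprD; apply/eqP; rewrite -subr_eq0 -mulrBr sm.
by rewrite phiE -[in RHS]scalerA psiE scalerA exprD.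
Qed.

End Presentation.

Lemma locally_free_framed n (s : 'I_n -> A) :
  generates (s : 'I_n -> A^o) ->
  (forall i, lmod_iso (locring (s i))^o (locmod (s i) L)) -> locally_framed L.
Proof.
move=> sgen iso.
have s_out : forall p : primeIdeal A, exists i, s i \notin p.
  by apply/unimodularP; exact: sgen.
have /choice[x loc] i := iso_local_generator (iso i).
have gen y : spanned x y.
  apply: submod_local => [|p]; first exact: submod_spanned.
  have [i nsi] := s_out p; have [m [a e]] := (loc i).1 y.
  exists (s i ^+ m); rewrite ?prime_idealX // e.
  by apply: submodZ; [exact: submod_spanned|exact: mem_spanned].
have /choice[N /choice[a aE]] i := uniform_coord x (loc i).
(* These are the vectors of [local_relation] for all [i] together. A power of any [s i] brings a
   given relation into their span, so it lies there by [submod_local]. *)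
pose r (e : 'I_n * 'I_n) : {ffun 'I_n -> A^o} :=
  s e.1 ^+ N e.1 *: unit_vec e.2 - a e.1 e.2 *: unit_vec e.1.
have r0 e : lincomb x (r e) = 0.
  by rewrite linearB !linearZ /= !lincomb_unit aE scalerN subrr.
have rel c : lincomb x c = 0 -> spanned r c.
  move=> c0; apply: submod_local => [|p]; first exact: submod_spanned.
  have [i nsi] := s_out p; have [m [d e]] := local_relation (loc i) (aE i) c0.
  exists (s i ^+ m); rewrite ?prime_idealX // e.
  have subr := submod_spanned r.
  apply: submod_sum => // j; apply: submodZ => //.
  exact: (mem_spanned r (i, j)).
move=> p; have [i nsi] := s_out p.
have [m [phi frame]] := local_generator_frame gen r0 rel (loc i).
by exists (s i ^+ m); [exact: prime_idealX|exists (x i), phi].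
Qed.

End LocalGenerator.

(** * Determinants modulo a prime and the determinant trick *)

Section ResMorphism.
Variables (A : comPzRingType) (p : primeIdeal A).

Lemma res_zmod_morphism : zmod_morphism (res p).
Proof.
by move=> a b; apply/eqP; rewrite eq_sym subr_eq resD subrK.
Qed.

Lemma res_monoid_morphism : monoid_morphism (res p).
Proof. by split=> // a b; rewrite resM. Qed.

HB.instance Definition _ :=
  GRing.isZmodMorphism.Build A (residue p) (res p) res_zmod_morphism.
HB.instance Definition _ :=
  GRing.isMonoidMorphism.Build A (residue p) (res p) res_monoid_morphism.

(** Modulo [p] the matrix becomes scalar, of determinant [s ^+ n], nonzero in the domain [A/p]. *)
Lemma det_scalar_sub_notin n (s : A) (M : 'M[A]_n) :
  s \notin p -> (forall i j, M i j \in p) -> \det (s%:M - M) \notin p.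
Proof.
move=> ns pM; rewrite -res_eq0 -det_map_mx.
have -> : map_mx (res p) (s%:M - M) = (res p s)%:M.
  apply/matrixP => i j; rewrite !mxE rmorphB rmorphMn /=.
  by rewrite (eqP (_ : res p (M i j) == 0)) ?subr0 // res_eq0.
by rewrite det_scalar expf_neq0 // res_eq0.
Qed.

End ResMorphism.

(** Multiply the system on the left by the adjugate of [N]. *)
Lemma det_annihilates (A : comPzRingType) (V : lmodType A) n (N : 'M[A]_n)
    (y : 'I_n -> V) :
  (forall k, \sum_l N k l *: y l = 0) -> forall k, \det N *: y k = 0.
Proof.
move=> Ny k; transitivity (\sum_l (\det N)%:M k l *: y l).
  rewrite (bigD1 k) //= big1 ?addr0 => [|l /negbTE ne].
    by rewrite mxE eqxx.
  by rewrite mxE eq_sym ne scale0r.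
rewrite -mul_adj_mx.
transitivity (\sum_m \adj N k m *: \sum_l N m l *: y l); last first.
  by rewrite big1 // => m _; rewrite Ny scaler0.
under eq_bigr do rewrite mxE scaler_suml.
rewrite exchange_big; apply: eq_bigr => m _; rewrite scaler_sumr.
by apply: eq_bigr => l _; rewrite scalerA.
Qed.

(** * From an invertible module to local frames *)

Section Invertible.
Variables (A : comPzRingType) (L : lmodType A).

(** Lifting the identity of [L] through the surjection [lincomb x] gives a section, whose components
    are the [phi i]. *)
Lemma projective_dual_basis (T : finType) (x : T -> L) :
  projective L -> (forall y, spanned x y) ->
  exists phi : T -> {linear L -> A^o}, forall y, y = \sum_i (phi i y : A) *: x i.
Proof.
move=> projL gen.
have [h hE] := projL _ _ (lincomb x : {linear _ -> _}) idfun (lincomb_surj gen).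
have /choice[phi phiE] i : exists phi : {linear L -> A^o},
    phi =1 fun y => h y i.
  by apply: linear_ex => a y z; rewrite linearP !ffunE.
exists phi => y; rewrite -[LHS]hE; apply: eq_bigr => i _.
by rewrite phiE.
Qed.

Section Rank1.
Variable p : primeIdeal A.
Hypothesis dimL : has_dim (fibre p L : lmodType (resfield p)) 1.

(** If [L = pL], any two elements of the fibre coincide, but a line has two distinct ones. *)
Lemma rank1_not_prime_smul : exists y, y \notin @prime_smul A p L.
Proof.
have [[f linf [g fK gK]]] := dimL.
apply: contrapT => /forallNP pL.
have g0 v : g v = g 0.
  have [y [r ->]] : exists y r, g v = mkfrac (toquot p y) r.
    by elim/fibreW: (g v) => z q; exists z, q.
  have [z [q ->]] : exists y r, g 0 = mkfrac (toquot p y) r.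
    by elim/fibreW: (g 0) => z q; exists z, q.
  apply/fibre_eqP; exists 1; rewrite ?prime_ideal1 // scale1r.
  exact/negPn/negP/pL.
have /matrixP/(_ 0 0)/eqP := can_inj gK (etrans (g0 (const_mx 1)) (esym (g0 0))).
by rewrite !mxE oner_eq0.
Qed.

(** The images of [y] and [z] in the line [fibre p L] are proportional; clearing denominators
    carries the proportion to [L] modulo [pL]. *)
Lemma rank1_dependent (y z : L) : exists a b : A,
  ((a \notin p) || (b \notin p)) /\
  a *: y + b *: z \in @prime_smul A p L.
Proof.
have [[f linf [g fK gK]]] := dimL.
have [F FE] := linear_ex linf.
have f_eq0 v : f v 0 0 = 0 -> v = 0.
  move=> v0; apply: (can_inj fK); rewrite -!FE linear0 FE.
  by apply/matrixP => i j; rewrite !ord1 v0 mxE.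
pose v : fibre p L := mkfrac (toquot p y) (denom1 _).
pose w : fibre p L := mkfrac (toquot p z) (denom1 _).
have [/f_eq0 v0|fv0] := eqVneq (f v 0 0) 0.
  have /fibre_eqP[u nu] : v = mkfrac (toquot p 0) (denom1 _) by rewrite toquot0.
  rewrite scaler0 subr0 scale1r => pu; exists u, 0.
  by rewrite nu scale0r addr0.
have wE : w = (f w 0 0 / f v 0 0) *: v.
  apply: subr0_eq; apply: f_eq0.
  by rewrite -FE linearB linearZ /= !FE !mxE divfK // subrr.
elim/resfracW: (f w 0 0 / f v 0 0) wE => a r.
rewrite scale_resfrac scale_toquot => /fibre_eqP[u nu] /=.
rewrite scale1r mulr1 scalerBr !scalerA => pu; exists (- (u * a)), (u * sval r).
rewrite scaleNr addrC pu; split=> //; apply/orP; right.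
by apply/negP => /prime_ideal_prime; rewrite (negbTE nu) (negbTE (svalP r)).
Qed.

(** Applying both forms to a dependence between [y] and [z] gives two linear equations in [a], [b]
    modulo [p]. Elimination puts [a] and [b] times the minor in [p], and one of them is outside
    [p]. *)
Lemma rank1_minor (phi psi : {linear L -> A^o}) (y z : L) :
  (phi y : A) * psi z - (phi z : A) * psi y \in p.
Proof.
have [a [b [nab pab]]] := rank1_dependent y z.
have expand (xi : {linear L -> A^o}) : (a * xi y + b * xi z : A) \in p.
  by rewrite -!linearZo -linearD; exact: linear_prime_smul.
have := expand phi; have := expand psi.
set y1 : A := phi y; set z1 : A := phi z.
set y2 : A := psi y; set z2 : A := psi z.
move=> p2 p1.
have pa : a * (y1 * z2 - z1 * y2) \in p.
  rewrite (_ : _ * _ = z2 * (a * y1 + b * z1) - z1 * (a * y2 + b * z2)); last ring.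
  by rewrite rpredB ?prime_idealMl.
have pb : b * (y1 * z2 - z1 * y2) \in p.
  rewrite (_ : _ * _ = y1 * (a * y2 + b * z2) - y2 * (a * y1 + b * z1)); last ring.
  by rewrite rpredB ?prime_idealMl.
by case/orP: nab => /negbTE na; [have := prime_ideal_prime _ _ pa|
  have := prime_ideal_prime _ _ pb]; rewrite na.
Qed.

End Rank1.

Lemma invertible_framed : invertible L -> locally_framed L.
Proof.
move=> [projL [n [x gen]] rank] p; have dimL := rank p.
have [phi dual] := projective_dual_basis projL gen.
(* If every [phi j (x i)] lay in [p], the dual basis would give [L = pL]. *)
have [i [j ns]] : exists i j, (phi j (x i) : A) \notin p.
  apply: contrapT => /forallNP pP.
  have [y /negP[]] := rank1_not_prime_smul dimL.
  have px i : x i \in @prime_smul A p L.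
    rewrite (dual (x i)) rpred_sum // => j _; apply: mem_prime_smul.
    by apply/negPn/negP => npij; case: (pP i); exists j.
  by rewrite (dual y) rpred_sum // => i _; rewrite prime_smulZ.
set s : A := phi j (x i) in ns.
(* The obstruction to [x k] being [phi j (x k) / s] times [x i], to be killed by an element outside
   [p]. *)
pose y k := s *: x k - (phi j (x k) : A) *: x i.
pose M : 'M[A]_n := \matrix_(k, l) phi l (y k).
(* The entry is the minor of [phi j] and [phi l] at [x i] and [x k]. *)
have pM k l : M k l \in p.
  rewrite mxE linearB /= !(linearZo (phi l)).
  exact: (rank1_minor dimL (phi j) (phi l) (x i) (x k)).
have nu := det_scalar_sub_notin ns pM.
have uy : forall k, \det (s%:M - M) *: y k = 0.
  apply: det_annihilates => k.
  have yj : phi j (y k) = 0.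
    by rewrite linearB /= !(linearZo (phi j)) -/s mulrC subrr.
  (* Substituting [s *: x l = y l + phi j (x l) *: x i] in the expansion of [s *: y k] leaves the
     extra term [phi j (y k) *: x i], which vanishes. *)
  have sy : s *: y k = \sum_l M k l *: y l.
    rewrite [in LHS](dual (y k)) scaler_sumr.
    transitivity (\sum_l M k l *: y l + (phi j (y k) : A) *: x i).
      have -> : phi j (y k) = \sum_l M k l * phi j (x l) :> A.
        rewrite [in LHS](dual (y k)) linear_sum; apply: eq_bigr => l _.
        by rewrite (linearZo (phi j)) mxE.
      rewrite scaler_suml -big_split; apply: eq_bigr => l _ /=.
      rewrite -scalerA -scalerDr subrK mxE !scalerA.
      by rewrite mulrC.
    by rewrite yj scale0r addr0.
  under eq_bigr do rewrite !mxE scalerBl.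
  rewrite sumrB (bigD1 k) //= big1 => [|l /negbTE ne]; last first.
    by rewrite eq_sym ne scale0r.
  rewrite eqxx addr0 mulr1n sy; apply/eqP; rewrite subr_eq0; apply/eqP.
  by apply: eq_bigr => l _; rewrite mxE.
set u := \det _ in nu uy.
have [psi psiE] : exists psi : {linear L -> A^o}, psi =1 fun z => u * phi j z.
  by apply: linear_ex => a z w; rewrite linearP /GRing.scale /=; ring.
exists (u * s).
  by apply/negP => /prime_ideal_prime; rewrite (negbTE nu) (negbTE ns).
exists (x i), psi; split=> [|z]; first by rewrite psiE.
rewrite psiE [in RHS](dual z) linear_sum mulr_sumr scaler_suml.
rewrite [in LHS](dual z) scaler_sumr; apply: eq_bigr => k _.
rewrite linearZo; apply/eqP; rewrite -subr_eq0; apply/eqP.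
(* The [k]-th terms of the two sides differ by this multiple of [u *: y k]. *)
transitivity ((phi k z : A) *: (u *: y k)); last by rewrite uy scaler0.
by rewrite !(scalerA, scalerBr); congr (_ *: _ - _ *: _); ring.
Qed.

End Invertible.

Theorem proposition5p1p2 (A : comPzRingType) (L : lmodType A) :
  invertible L <->
  exists n (s : 'I_n -> A),
    generates (s : 'I_n -> A^o) /\
    forall i : 'I_n, lmod_iso (locring (s i))^o (locmod (s i) L).
Proof.
split=> [/invertible_framed|[n [s [sgen iso]]]].
  exact: locally_framed_locally_free.
exact/locally_framed_invertible/(locally_free_framed sgen iso).
Qed.
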